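(* Consider the hybrid system $\dot\zeta=\overline f(\zeta)$ for $\zeta\in\overline C$, $\zeta^+=\overline g(\zeta)$ for $\zeta\in\overline D$ (power network with hysteretic on-off loads with two power-command thresholds), defined in the context. Suppose that Design condition 2 stated in the context holds and that $\alpha_j=c_j^{-1}$ for all $j\in N$. Let $\zeta^*=(\eta^*,\omega^*,p^{M,*},\sigma^* )$ be an equilibrium of the hybrid system and let $d^{c,*}_j=\overline d_j\sigma^*_j$, $d^{u,*}_j=A_j\omega^*_j$, $j\in N$. Then $(p^{M,*},d^{c,*},d^{u,*})$ is $\epsilon$-optimal for the H-OSLC problem stated in the context, with $$\epsilon=\frac{1}{2\mathcal{D}}\max_{j\in N}(\overline d_j)^2 .$$
   Context: Network: $(N,E)$ is a finite connected graph with bus set $N=\{1,\dots,|N|\}$ and line set $E\subseteq N\times N$, directed with an arbitrary orientation so that $(i,j)\in E$ implies $(j,i)\notin E$. For $j\in N$, $N^i_j=\{i:(i,j)\in E\}$, $N^o_j=\{k:(j,k)\in E\}$. Constants: $B_{ij}>0$ for $(i,j)\in E$; $M_j,\tau_j,A_j,\alpha_j,\overline d_j,c_j,c^d_j>0$, $p^L_j\in\mathbb{R}$, thresholds $\omega^1_j>\omega^0_j>0$ and $\overline p^c_j>\underline p^c_j$ for $j\in N$. Put $\mathcal{D}=\sum_{j\in N}(\alpha_j+A_j)$, $\ell=\sum_{j\in N}p^L_j$, and let the power command be the constant $p^c=-\ell$. H-OSLC problem: with $C_{h,j}(0)=0$ and $C_{h,j}(\overline d_j)=c^d_j$, $$\min_{p^M,d^c,d^u}\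 \sum_{j\in N}\Big(\frac{c_j}{2}(p^M_j)^2+C_{h,j}(d^c_j)+\frac{1}{2A_j}(d^u_j)^2\Big)$$ subject to $\sum_{j\in N}(p^M_j-d^u_j-p^L_j)=\sum_{j\in N}d^c_j$ and $d^c_j\in\{0,\overline d_j\}$, $j\in N$. A (feasible) point is $\epsilon$-optimal, $\epsilon>0$, if its cost is at most the minimum cost of the problem plus $\epsilon$. Design condition 2: let $\pi$ be a permutation of $N$ ranking the loads in ascending order of $c^d_j/\overline d_j$ (ties broken arbitrarily), and write $x_{\underline k}=x_{\pi(k)}$ for the parameter $x$ of the $k$-th ranked load. Then $\omega^0_k=c^d_k/\overline d_k$ for $k\in N$; $\underline p^c_{\underline 1}=\mathcal{D}\,\omega^0_{\underline 1}$; $\underline p^c_{\underline k}=\mathcal{D}\,\omega^0_{\underline k}+\sum_{j=1}^{k-1}\overline d_{\underline j}$ for $k\in N\setminus\{1\}$; and $\overline p^c_{\underline j}\in(\underline p^c_{\underline j},\underline p^c_{\underline j}+\overline\delta)$ for $j\in N$, where $\overline\delta=\min_{j\in N}\overline d_j$. State: $\zeta=(x,\sigma)\in\Lambda=\mathbb{R}^n\times\{0,1\}^{|N|}$, with $x=(\eta,\omega,p^M)\in\mathbb{R}^n$, $n=|E|+2|N|$, and $\sigma$ the on/off states of the loads. Flow map $\overline f$: with $p_{ij}=B_{ij}\eta_{ij}$, $\dot\eta_{ij}=\omega_i-\omega_j$, $(i,j)\in E$; $M_j\dot\omega_j=-p^L_j+p^M_j-(\overline d_j\sigma_j+A_j\omega_j)-\sum_{k\in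 N^o_j}p_{jk}+\sum_{i\in N^i_j}p_{ij}$, $j\in N$; $\tau_j\dot p^M_j=-(p^M_j+\alpha_j\omega_j)$, $j\in N$; $\dot\sigma_j=0$, $j\in N$. Flow set: $\overline C=\{\zeta\in\Lambda:\sigma_j\in\mathcal J_j(\omega_j,p^c)\ \forall j\in N\}$, where $\mathcal J_j(\omega_j,p^c)=\{1\}$ if $\omega_j>\omega^1_j$ or $p^c>\overline p^c_j$; $=\{0\}$ if $\omega_j<\omega^0_j$ and $p^c<\underline p^c_j$; $=\{0,1\}$ if $\omega^0_j\le\omega_j\le\omega^1_j$ and $p^c\le\overline p^c_j$, or if $\omega_j\le\omega^0_j$ and $\underline p^c_j\le p^c\le\overline p^c_j$. Jump set: $\overline D=(\Lambda\setminus\overline C)\cup\tilde D$, where $\tilde D$ is the set of $\zeta\in\Lambda$ such that for some $j\in N$ either ($\sigma_j=0$ and ($\omega_j=\omega^1_j$ or $p^c=\overline p^c_j$)), or ($\sigma_j=1$, $\omega_j\le\omega^0_j$ and $p^c=\underline p^c_j$), or ($\sigma_j=1$, $\omega_j=\omega^0_j$ and $p^c\le\underline p^c_j$). Jump map $\overline g$: $x^+=x$ and, for each $j\in N$, $\sigma_j^+=1$ if $\omega_j\ge\omega^1_j$ or $p^c\ge\overline p^c_j$; $\sigma_j^+=0$ if $\omega_j\le\omega^0_j$ and $p^c\le\underline p^c_j$; $\sigma_j^+=\sigma_j$ otherwise. Equilibrium: a point $\zeta^*$ with ($\zeta^*\in\overline C$ and $\overline f(\zeta^* )=0$) or ($\zeta^*\in\overline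 D$ and $\overline g(\zeta^* )=\zeta^*$). *)

(* Defs.v *)
From mathcomp Require Import all_boot all_order all_algebra.
From mathcomp Require Import perm.
From mathcomp Require Import classical_sets reals.

Set Implicit Arguments.
Unset Strict Implicit.
Unset Printing Implicit Defensive.

Import Order.TTheory GRing.Theory Num.Theory.

Local Open Scope classical_set_scope.
Local Open Scope ring_scope.

Record hybrid_system (V : zmodType) := HybridSystem {
  flow_set : set V;
  flow_map : V -> V;
  jump_set : set V;
  jump_map : V -> V }.

Definition equilibrium (V : zmodType) (H : hybrid_system V) (z : V) : Prop :=
  (flow_set H z /\ flow_map H z = 0) \/ (jump_set H z /\ jump_map H z = z).

Definition optimal (R : realType) (T : Type) (F : set T) (J : T -> R) (q : T) :
    Prop :=
  F q /\ forall r, F r -> J q <= J r.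

Definition eps_optimal (R : realType) (T : Type) (F : set T) (J : T -> R)
    (eps : R) (p : T) : Prop :=
  [/\ 0 < eps, F p & exists2 q, optimal F J q & J p <= J q + eps].

(* The bus set is 'I_n.+1: it is nonempty, and buses are numbered from 0. *)
Notation bus n := 'I_n.+1.

Notation line E := {e | e \in E}.

Definition adjacent (n : nat) (E : {set bus n * bus n}) : rel (bus n) :=
  fun i j => ((i, j) \in E) || ((j, i) \in E).

(* [pcmin] and [pcmax] are the lower and upper power-command thresholds. *)
Record network (R : realType) (n : nat) := Network {
  lines : {set bus n * bus n};
  lines_oriented : forall i j, (i, j) \in lines -> (j, i) \notin lines;
  lines_connected : forall i j, connect (adjacent lines) i j;
  B : line lines -> R;
  M : bus n -> R;
  tau : bus n -> R;
  A : bus n -> R;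
  alpha : bus n -> R;
  dbar : bus n -> R;
  c : bus n -> R;
  cd : bus n -> R;
  pL : bus n -> R;
  omega0 : bus n -> R;
  omega1 : bus n -> R;
  pcmin : bus n -> R;
  pcmax : bus n -> R;
  B_gt0 : forall e, 0 < B e;
  M_gt0 : forall j, 0 < M j;
  tau_gt0 : forall j, 0 < tau j;
  A_gt0 : forall j, 0 < A j;
  alpha_gt0 : forall j, 0 < alpha j;
  dbar_gt0 : forall j, 0 < dbar j;
  c_gt0 : forall j, 0 < c j;
  cd_gt0 : forall j, 0 < cd j;
  omega0_gt0 : forall j, 0 < omega0 j;
  omega0_lt_omega1 : forall j, omega0 j < omega1 j;
  pcmin_lt_pcmax : forall j, pcmin j < pcmax j }.

Arguments B {R n} net e : rename.

Section PowerNetwork.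
Variables (R : realType) (n : nat) (net : network R n).

Definition total_damping : R := \sum_(j < n.+1) (alpha net j + A net j).

Definition total_load : R := \sum_(j < n.+1) pL net j.

Definition power_command : R := - total_load.

Definition min_dbar : R :=
  \big[Num.min/dbar net ord0]_(j < n.+1) dbar net j.

Definition max_dbar_sq : R :=
  \big[Num.max/dbar net ord0 ^+ 2]_(j < n.+1) dbar net j ^+ 2.

(* Ranks are numbered from 0, and the sum is empty at the first one. *)
Definition design_condition2 : Prop :=
  exists pi : {perm bus n},
  [/\ forall k l : bus n, (k <= l)%N ->
        cd net (pi k) / dbar net (pi k) <= cd net (pi l) / dbar net (pi l),
      forall k : bus n, omega0 net k = cd net k / dbar net k,
      forall k : bus n, pcmin net (pi k) =
        total_damping * omega0 net (pi k)
        + \sum_(j < n.+1 | (j < k)%N) dbar net (pi j)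
    & forall j : bus n, pcmin net j < pcmax net j < pcmin net j + min_dbar].

(* zeta = (x, sigma) with x = (eta, omega, p^M); the on/off states are embedded
   in the reals so that the state space [Lambda] is a subset of a vector space
   on which both the flow map and the jump map act. *)
Definition state : zmodType :=
  ({ffun line (lines net) -> R} * {ffun bus n -> R} * {ffun bus n -> R}
   * {ffun bus n -> R})%type.

Definition eta (z : state) : {ffun line (lines net) -> R} := z.1.1.1.
Definition omega (z : state) : {ffun bus n -> R} := z.1.1.2.
Definition pM (z : state) : {ffun bus n -> R} := z.1.2.
Definition sigma (z : state) : {ffun bus n -> R} := z.2.

Definition Lambda : set state :=
  [set z | forall j, sigma z j = 0 \/ sigma z j = 1].

Definition power_flow (z : state) (e : line (lines net)) : R :=
  B net e * eta z e.

(* The out-neighbours (in-neighbours) of j correspond to the lines whose first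
   (second) endpoint is j, over which the flow sums range. *)
Definition flow_map_net (z : state) : state :=
  ([ffun e : line (lines net) => omega z (val e).1 - omega z (val e).2],
   [ffun j => (- pL net j + pM z j
               - (dbar net j * sigma z j + A net j * omega z j)
               - \sum_(e : line (lines net) | (val e).1 == j) power_flow z e
               + \sum_(e : line (lines net) | (val e).2 == j) power_flow z e)
              / M net j],
   [ffun j => - (pM z j + alpha net j * omega z j) / tau net j],
   [ffun=> 0]).

Definition admissible (j : bus n) (w pc : R) : set R :=
  [set s |
    [\/ (omega1 net j < w \/ pcmax net j < pc) /\ s = 1,
        (w < omega0 net j /\ pc < pcmin net j) /\ s = 0
      | ((omega0 net j <= w <= omega1 net j /\ pc <= pcmax net j) \/
         (w <= omega0 net j /\ pcmin net j <= pc <= pcmax net j))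
        /\ (s = 0 \/ s = 1)]].

Definition flow_set_net : set state :=
  [set z | Lambda z /\
    forall j, admissible j (omega z j) power_command (sigma z j)].

Definition switching_boundary : set state :=
  [set z | Lambda z /\ exists j,
    [\/ sigma z j = 0 /\
          (omega z j = omega1 net j \/ power_command = pcmax net j),
        [/\ sigma z j = 1, omega z j <= omega0 net j
          & power_command = pcmin net j]
      | [/\ sigma z j = 1, omega z j = omega0 net j
          & power_command <= pcmin net j]]].

Definition jump_set_net : set state :=
  (Lambda `\` flow_set_net) `|` switching_boundary.

Definition jump_map_net (z : state) : state :=
  (z.1,
   [ffun j =>
     if (omega1 net j <= omega z j) || (pcmax net j <= power_command) then 1
     else if (omega z j <= omega0 net j) && (power_command <= pcmin net j)
     then 0
     else sigma z j]).

Definition network_system : hybrid_system state :=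
  HybridSystem flow_set_net flow_map_net jump_set_net jump_map_net.

(* decision variables (p^M, d^c, d^u) *)
Definition decision : Type :=
  ({ffun bus n -> R} * {ffun bus n -> R} * {ffun bus n -> R})%type.

Definition hoslc_cost (Ch : bus n -> R -> R) (y : decision) : R :=
  let: (p, dc, du) := y in
  \sum_(j < n.+1) (c net j / 2 * p j ^+ 2 + Ch j (dc j)
                   + 1 / (2 * A net j) * du j ^+ 2).

Definition hoslc_feasible : set decision :=
  [set y : decision | let: (p, dc, du) := y in
    \sum_(j < n.+1) (p j - du j - pL net j) = \sum_(j < n.+1) dc j /\
    forall j, dc j = 0 \/ dc j = dbar net j].

Definition controllable_demand (z : state) : {ffun bus n -> R} :=
  [ffun j => dbar net j * sigma z j].

Definition uncontrollable_demand (z : state) : {ffun bus n -> R} :=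
  [ffun j => A net j * omega z j].

End PowerNetwork.

(* Main.v *)
(** An equilibrium must be a flow equilibrium, since every jump changes the on-off
    states.  There the frequencies all equal one value [w], and summing the power
    balances gives [D w = pc - s] with [s] the demand of the loads that are on.
    By Lagrangian duality, for every multiplier [a] such that the loads that are
    on have [omega0 <= a] and those that are off have [a <= omega0], the cost
    at the equilibrium exceeds the cost of any feasible point by at most
    [D (a - w)^2 / 2].  The thresholds force the loads that are on to be an
    initial segment of the ranking.  Taking [a = w] when this separates, and
    otherwise [omega0] at the last load that is on or at the first one that is
    off, makes [D |a - w|] at most the demand of a single load. *)
Require Import Defs.
From mathcomp Require Import all_boot all_order all_algebra.
From mathcomp Require Import perm.
From mathcomp Require Import classical_sets reals.
From mathcomp Require Import ring lra.

Import Order.TTheory GRing.Theory Num.Theory.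

Local Open Scope classical_set_scope.
Local Open Scope ring_scope.

Section Network.
Set Implicit Arguments.
Unset Strict Implicit.
Variables (R : realType) (n : nat) (net : network R n).

Local Notation D := (total_damping net).
Local Notation pc := (power_command net).

(** * Equilibria: uniform frequency and power balance *)

Lemma total_damping_gt0 : 0 < D.
Proof.
rewrite /total_damping big_ord_recl ltr_pwDl //.
  by rewrite addr_gt0 ?alpha_gt0 ?A_gt0.
by apply: sumr_ge0 => j _; rewrite addr_ge0 ?ltW ?alpha_gt0 ?A_gt0.
Qed.

(** A fixed point of the jump map is admissible at every load, so it cannot lie outside the flow
    set. On the switching boundary the jump map flips the state of some load, so no fixed point lies
    there. *)
Lemma equilibrium_flow (z : state net) :
  equilibrium (network_system net) z ->
  flow_set_net z /\ flow_map_net z = 0.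
Proof.
case=> // -[/= zD gz].
have gzE j : sigma (jump_map_net z) j = sigma z j by rewrite gz.
have {gz}step j : (if (omega1 net j <= omega z j) || (pcmax net j <= pc)
    then 1 else if (omega z j <= omega0 net j) && (pc <= pcmin net j)
    then 0 else sigma z j) = sigma z j.
  by rewrite -[RHS]gzE [in RHS]ffunE.
have neq01 : (0 : R) <> 1 by apply/eqP; rewrite eq_sym oner_eq0.
case: zD => [[zL nC]|[zL [j]]].
  case: nC; split=> // j; have := step j; have := zL j.
  have := omega0_lt_omega1 net j; have := pcmin_lt_pcmax net j.
  rewrite /admissible /=.
  move: (omega z j) (sigma z j) pc => w s p pcm om sP.
  case: (ltrP (omega1 net j) w) => [w1|w1].
    by rewrite (ltW w1) /= => <-; apply: Or31; split=> //; left.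
  case: (ltrP (pcmax net j) p) => [p1|p1].
    by rewrite (ltW p1) orbT /= => <-; apply: Or31; split=> //; right.
  case: (lerP (omega0 net j) w) => [w0|w0] st.
    by apply: Or33; split=> //; left.
  case: (lerP (pcmin net j) p) => [p0|p0].
    by apply: Or33; split=> //; right; rewrite ltW.
  apply: Or32; split=> //; move: st.
  rewrite (ltW w0) (ltW p0) /= leNgt (lt_trans w0 om) /=.
  by rewrite leNgt (lt_trans p0 pcm) /= => <-.
move=> bd; have := step j; have om := omega0_lt_omega1 net j.
have pcm := pcmin_lt_pcmax net j; case: bd.
- case=> s0 [->|->]; rewrite lexx ?orbT s0; by move/esym/neq01.
- case=> s1 w0 p0.
  rewrite leNgt (le_lt_trans w0 om) w0 s1 p0 lexx /= leNgt pcm /=.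
  by move/neq01.
- case=> s1 w0 p0.
  by rewrite s1 w0 leNgt om lexx p0 /= leNgt (le_lt_trans p0 pcm) /= => /neq01.
Qed.

Lemma flow_equilibrium_omega (z : state net) :
  flow_map_net z = 0 -> forall j, omega z j = omega z ord0.
Proof.
move=> fz; have edge i j : (i, j) \in lines net -> omega z i = omega z j.
  move=> ij; pose e : line (lines net) := exist _ (i, j) ij.
  have /ffunP/(_ e) : (flow_map_net z).1.1.1 = 0 by rewrite fz.
  by rewrite !ffunE /= => /eqP; rewrite subr_eq0 => /eqP.
move=> j; have /connectP[p] := lines_connected net ord0 j.
(* The start of the path is generalized, so the induction follows the path edge by edge, in either
   orientation. *)
elim: p (ord0 : bus n) => [i _ -> //|k p IH i /= /andP[ik kp] jE].
rewrite (IH k kp jE); case/orP: ik => /edge // ->.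
Qed.

Lemma flow_equilibrium_pM (z : state net) :
  flow_map_net z = 0 -> forall j, pM z j = - (alpha net j * omega z j).
Proof.
move=> fz j; have /ffunP/(_ j) : (flow_map_net z).1.2 = 0 by rewrite fz.
rewrite !ffunE => /eqP; rewrite mulf_eq0 invr_eq0 [tau _ _ == _]gt_eqF ?tau_gt0 // orbF.
by rewrite oppr_eq0 addr_eq0 => /eqP.
Qed.

Lemma flow_equilibrium_balance (z : state net) :
  flow_map_net z = 0 ->
  \sum_(j < n.+1) (pM z j - A net j * omega z j - pL net j)
    = \sum_(j < n.+1) dbar net j * sigma z j.
Proof.
(* Summed over the buses, outgoing and incoming flows each count every line exactly once, so they
   cancel. *)
move=> fz; have sumE (f : line (lines net) -> bus n) :
    \sum_j \sum_(e | f e == j) power_flow z e = \sum_e power_flow z e.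
  by rewrite [RHS](partition_big f predT).
apply/eqP; rewrite -subr_eq0 -sumrB; apply/eqP.
rewrite -[RHS](subrr (\sum_e power_flow z e)).
rewrite -{1}(sumE (fun e => (val e).1)) -(sumE (fun e => (val e).2)) -sumrB.
apply: eq_bigr => j _.
have /ffunP/(_ j) : (flow_map_net z).1.1.2 = 0 by rewrite fz.
rewrite !ffunE => /eqP; rewrite mulf_eq0 invr_eq0 [M _ _ == _]gt_eqF ?M_gt0 //.
rewrite orbF => /eqP bal; lra.
Qed.

Lemma flow_equilibrium_frequency (z : state net) :
  flow_map_net z = 0 ->
  D * omega z ord0 = pc - \sum_(j < n.+1) dbar net j * sigma z j.
Proof.
move=> fz; rewrite -(flow_equilibrium_balance fz) /power_command /total_load.
rewrite /total_damping mulr_suml -sumrN -sumrB; apply: eq_bigr => j _.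
rewrite (flow_equilibrium_pM fz) (flow_equilibrium_omega fz j); ring.
Qed.

(** * Duality bounds on the cost, and existence of an optimum *)

Section Cost.
Variables (Ch : bus n -> R -> R).
Hypothesis alphaE : forall j, alpha net j = (c net j)^-1.

(* Weak duality for the supply constraint, with multiplier [a]. *)
Lemma hoslc_cost_ge (a : R) (p dc du : {ffun bus n -> R}) :
  hoslc_feasible net (p, dc, du) ->
  a * (pc - \sum_(j < n.+1) dc j) - D * a ^+ 2 / 2 + \sum_(j < n.+1) Ch j (dc j)
    <= hoslc_cost net Ch (p, dc, du).
Proof.
case=> <- _; rewrite /hoslc_cost /power_command /total_load /total_damping.
rewrite -sumrN -sumrB mulr_sumr !mulr_suml -sumrB -big_split /=.
apply: ler_sum => j _; rewrite alphaE.
have c0 := c_gt0 net j; have A0 := A_gt0 net j; rewrite -subr_ge0.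
(* Completing the squares: the slack vanishes at [p j = - a / c j] and [du j = A j * a], the
   response to a frequency [a]. *)
have -> : c net j / 2 * p j ^+ 2 + Ch j (dc j) + 1 / (2 * A net j) * du j ^+ 2
    - (a * (- pL net j - (p j - du j - pL net j))
       - ((c net j)^-1 + A net j) * a ^+ 2 / 2 + Ch j (dc j))
  = c net j / 2 * (p j + a / c net j) ^+ 2
    + 1 / (2 * A net j) * (du j - A net j * a) ^+ 2.
  by field; rewrite !gt_eqF.
rewrite addr_ge0 // mulr_ge0 ?sqr_ge0 // mulr_ge0 ?invr_ge0 ?mulr_ge0 // ltW //.
Qed.

(** When [D * w = pc - \sum_j dc j], this value is the lower bound of [hoslc_cost_ge] at [a = w];
    the response to [w] is then the cheapest one for this [dc]. *)
Lemma hoslc_cost_droop (w : R) (dc : {ffun bus n -> R}) :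
  hoslc_cost net Ch
    ([ffun j => - (alpha net j * w)], dc, [ffun j => A net j * w])
  = D * w ^+ 2 / 2 + \sum_(j < n.+1) Ch j (dc j).
Proof.
rewrite /hoslc_cost /total_damping !mulr_suml -big_split /=.
apply: eq_bigr => j _; rewrite !ffunE alphaE; field.
by rewrite !gt_eqF ?c_gt0 ?A_gt0.
Qed.

Lemma hoslc_feasible_droop (w : R) (dc : {ffun bus n -> R}) :
  (forall j, dc j = 0 \/ dc j = dbar net j) ->
  D * w = pc - \sum_(j < n.+1) dc j ->
  hoslc_feasible net
    ([ffun j => - (alpha net j * w)], dc, [ffun j => A net j * w]).
Proof.
move=> dcP bal; split=> //.
have -> : \sum_(j < n.+1) dc j = pc - D * w by rewrite bal subKr.
rewrite /power_command /total_load /total_damping mulr_suml -sumrN -sumrB.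
by apply: eq_bigr => j _; rewrite !ffunE; ring.
Qed.

(** There are finitely many on-off patterns, and for each the optimal continuous variables are the
    response to the frequency that balances supply. It remains to minimize over a finite set. *)
Lemma hoslc_optimal_exists :
  exists q, optimal (hoslc_feasible net) (hoslc_cost net Ch) q.
Proof.
pose dc (S : {set bus n}) : {ffun bus n -> R} :=
  [ffun j => if j \in S then dbar net j else 0].
pose w S := (pc - \sum_j dc S j) / D.
pose q S : decision R n :=
  ([ffun j => - (alpha net j * w S)], dc S, [ffun j => A net j * w S]).
have DwE S : D * w S = pc - \sum_j dc S j.
  by rewrite mulrC divfK // gt_eqF // total_damping_gt0.
have [S _ Smin] := @arg_minP _ _ _ (finset.set0 : {set bus n}) xpredT
  (fun S => hoslc_cost net Ch (q S)) isT.
exists (q S); split=> [|[[p dr] du] Fr].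
  apply: hoslc_feasible_droop (DwE S) => j; rewrite ffunE.
  by case: ifP => _; [right|left].
pose T : {set bus n} := finset (fun j => dr j == dbar net j).
have drE : dr = dc T.
  apply/ffunP => j; rewrite ffunE inE; case: Fr => _ /(_ j)[] -> //.
    by rewrite eq_sym gt_eqF ?dbar_gt0.
  by rewrite eqxx.
apply: le_trans (Smin T isT) _; apply: le_trans (hoslc_cost_ge (w T) Fr).
by rewrite drE -DwE hoslc_cost_droop lerD2r; lra.
Qed.

(** In the Lagrangian, a load that is on contributes [dbar * (omega0 - a)] and one that is off
    contributes 0, so a separating [a] makes [s] optimal load by load. What is left is the quadratic
    loss from using the multiplier [a] instead of [w]. *)
Lemma hoslc_cost_le_separated (a w : R) (s : bus n -> bool)
    (p du dr : {ffun bus n -> R}) :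
  (forall j, Ch j 0 = 0) -> (forall j, Ch j (dbar net j) = cd net j) ->
  (forall j, omega0 net j = cd net j / dbar net j) ->
  (forall j, if s j then omega0 net j <= a else a <= omega0 net j) ->
  let dc := [ffun j => dbar net j * (s j)%:R] in
  D * w = pc - \sum_(j < n.+1) dc j ->
  hoslc_feasible net (p, dr, du) ->
  hoslc_cost net Ch ([ffun j => - (alpha net j * w)], dc, [ffun j => A net j * w])
    <= hoslc_cost net Ch (p, dr, du) + D * (a - w) ^+ 2 / 2.
Proof.
move=> Ch0 Ch1 om0 sep dc bal Fr.
rewrite hoslc_cost_droop -lerBlDr; apply: le_trans (hoslc_cost_ge a Fr).
have DwE : \sum_j dc j = pc - D * w by rewrite bal subKr.
suff : \sum_j (Ch j (dc j) - a * dc j) <= \sum_j (Ch j (dr j) - a * dr j).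
  by rewrite !sumrB -!mulr_sumr DwE; lra.
apply: ler_sum => j _; rewrite ffunE.
have d0 := dbar_gt0 net j.
have cdE : cd net j = omega0 net j * dbar net j by rewrite om0 divfK ?gt_eqF.
have := sep j; case: (s j); case: Fr => _ /(_ j)[] ->;
  rewrite ?mulr1 ?mulr0 ?Ch0 ?Ch1 ?cdE => ?; nra.
Qed.

End Cost.

(** * Ranked loads: initial segments and the separating multiplier *)

Section Ranking.
Variables (pi : {perm bus n}) (s : bus n -> bool) (w : R).

Let o k := omega0 net (pi k).
Let d k := dbar net (pi k).

Hypothesis o_sorted : forall k l : bus n, (k <= l)%N -> o k <= o l.
Hypothesis pcminE : forall k : bus n,
  pcmin net (pi k) = D * o k + \sum_(j < n.+1 | (j < k)%N) d j.
Hypothesis pcmax_gap : forall j, pcmax net j < pcmin net j + min_dbar net.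
Hypothesis balance : D * w = pc - \sum_(j < n.+1) dbar net j * (s j)%:R.
Hypothesis adm : forall j, admissible net j w pc (s j)%:R.

Lemma min_dbar_le j : min_dbar net <= dbar net j.
Proof. exact: bigmin_le. Qed.

Lemma dbar_sq_le_max j : dbar net j ^+ 2 <= max_dbar_sq net.
Proof. exact: le_bigmax. Qed.

Lemma on_of_pcmax_lt j : pcmax net j < pc -> s j.
Proof.
move=> ltp; have := adm j; have pm := pcmin_lt_pcmax net j.
case: (s j) => //; case.
- by case=> _ /esym/eqP; rewrite oner_eq0.
- by case=> -[_ p0] _; lra.
- by case=> -[[_ p0]|[_ /andP[_ p0]]] _; lra.
Qed.

Lemma on_threshold j : s j -> pcmin net j <= pc \/ omega0 net j <= w.
Proof.
move=> sj; have := adm j; rewrite sj.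
have pm := pcmin_lt_pcmax net j; have om := omega0_lt_omega1 net j.
case.
- by case=> -[]; [right|left]; lra.
- by case=> _ /eqP; rewrite oner_eq0.
- case=> -[[/andP[? _] _]|[_ /andP[? _]]] _; by [right|left].
Qed.

Lemma sum_onE : \sum_(j < n.+1) dbar net j * (s j)%:R
  = \sum_(k < n.+1 | s (pi k)) d k.
Proof.
rewrite (reindex_inj (@perm_inj _ pi)) [RHS]big_mkcond /=.
by apply: eq_bigr => k _; case: (s _); rewrite ?mulr1 ?mulr0.
Qed.

Lemma d_gt0 k : 0 < d k. Proof. exact: dbar_gt0. Qed.

(** Through [balance], this bounds the frequency from above. It serves both with [k] off and [l] a
    later load that is on, and with [l = k]. *)
Lemma sum_below_on_le (k l : bus n) :
  (forall i : bus n, (i < k)%N -> s (pi i)) -> (k <= l)%N -> s (pi l) ->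
  \sum_(j < n.+1 | (j < k)%N) d j + d l <= \sum_(j < n.+1 | s (pi j)) d j.
Proof.
move=> on_lt kl sl; rewrite [leRHS](bigID (fun j : bus n => (j < k)%N)) /=.
apply: lerD.
  rewrite le_eqVlt; apply/orP; left; apply/eqP/eq_bigl => j.
  by case: (ltnP j k) => [/on_lt ->|]; rewrite ?andbF.
rewrite (bigD1 l) /=; last by rewrite sl -leqNgt.
by rewrite lerDl sumr_ge0 // => i _; rewrite ltW ?d_gt0.
Qed.

(** The hysteresis bands of the ranked loads are disjoint: each is narrower than [min_dbar], while
    [pcmin] grows by at least [d j] from rank [j] to any later one. *)
Lemma pcmax_lt_pcmin (j k : bus n) :
  (j < k)%N -> pcmax net (pi j) < pcmin net (pi k).
Proof.
move=> jk; apply: lt_le_trans (pcmax_gap _) _; rewrite !pcminE -addrA lerD //.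
  by rewrite ler_wpM2l ?o_sorted ?(ltnW jk) ?(ltW total_damping_gt0).
rewrite [leRHS](bigID (fun i : bus n => (i < j)%N)) /=; apply: lerD.
  rewrite le_eqVlt; apply/orP; left; apply/eqP/eq_bigl => i.
  by case: (ltnP i j) => [ij|]; rewrite ?andbF // (ltn_trans ij jk).
rewrite (bigD1 j) /=; last by rewrite jk ltnn.
apply: le_trans (min_dbar_le (pi j)) _; rewrite -/(d j) lerDl sumr_ge0 // => i _.
by rewrite ltW ?d_gt0.
Qed.

Lemma on_initial (j k : bus n) : (j < k)%N -> s (pi k) -> s (pi j).
Proof.
(* Strong induction on [j]: all ranks below [j] are already known to be on, as [sum_below_on_le]
   requires. *)
move=> + sk; have [m] := ubnP j; elim: m j => // m IH j /[!ltnS] jm jk.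
have on_lt (i : bus n) : (i < j)%N -> s (pi i).
  by move=> ij; apply: IH; [exact: leq_trans ij jm|exact: ltn_trans ij jk].
apply: contraT => nsj; have pj : pc <= pcmax net (pi j).
  by rewrite leNgt; apply: contra nsj => /on_of_pcmax_lt.
have [p0|w0] := on_threshold sk; first by have := pcmax_lt_pcmin jk; lra.
(* Since [j] is off, [pc] is below [D * o j] plus the demand of the ranks under [j] plus [d k]. All
   this demand is on, so [w < o j <= o k], against [w0]. *)
have := sum_below_on_le on_lt (ltnW jk) sk.
have := min_dbar_le (pi k); rewrite -/(d k).
have := pcmax_gap (pi j); rewrite pcminE.
have := balance; rewrite sum_onE.
have := o_sorted (ltnW jk); have := total_damping_gt0.
by move: w0; rewrite -/(o k); nra.
Qed.

(** If the load is kept on by its frequency, then [pc], which is [D * w] plus the on demand, is at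
    least [D * o k] plus the demand of ranks up to [k], and this exceeds [pcmin]. *)
Lemma on_pcmin_le k : s (pi k) -> pcmin net (pi k) <= pc.
Proof.
move=> sk; have [//|w0] := on_threshold sk.
have on_lt (i : bus n) : (i < k)%N -> s (pi i) by move/on_initial; apply.
have := sum_below_on_le on_lt (leqnn k) sk.
have := balance; rewrite sum_onE pcminE.
have := total_damping_gt0; have := d_gt0 k.
by move: w0; rewrite -/(o k); nra.
Qed.

Lemma separator_exists : exists2 a : R,
  forall j, if s j then omega0 net j <= a else a <= omega0 net j
  & (D * (a - w)) ^+ 2 <= max_dbar_sq net.
Proof.
have D0 := total_damping_gt0.
have rank (P : bus n -> Prop) : (forall k, P (pi k)) -> forall j, P j.
  by move=> Pk j; rewrite -(permKV pi j).
(* Some load that is on has its threshold above [w]: take [a] at the last load that is on. *)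
have [/existsP[k0 /andP[sk0 wk0]]|/existsPn noC] :=
  boolP [exists k, s (pi k) && (w < o k)].
  have [k sk kmax] := @arg_maxnP _ k0 (fun k => s (pi k)) val sk0.
  exists (o k).
    apply: rank => i; case: ifPn => si; first exact/o_sorted/kmax.
    apply: o_sorted; rewrite leqNgt; apply: contra si => ik.
    exact: on_initial ik sk.
  apply: le_trans (dbar_sq_le_max (pi k)); rewrite -/(d k).
  have wk : w < o k by apply: lt_le_trans wk0 (o_sorted (kmax _ sk0)).
  have sumE : \sum_(j < n.+1 | s (pi j)) d j
      = d k + \sum_(j < n.+1 | (j < k)%N) d j.
    rewrite (bigD1 k) //=; congr (_ + _); apply: eq_bigl => i.
    rewrite -val_eqE; apply/andP/idP => [[/kmax ik ik']|ik].
      by rewrite ltn_neqAle ik'.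
    by rewrite (on_initial ik sk) /= ltn_eqF.
  (* Here [D * (o k - w)] equals [pcmin - pc + d k], which is at most [d k]. *)
  have := on_pcmin_le sk; have := balance; rewrite sum_onE sumE pcminE => bal pk.
  rewrite lerXn2r ?nnegrE ?(ltW (d_gt0 k)) //; last by lra.
  by rewrite mulr_ge0 ?subr_ge0 // ltW.
(* Some load that is off has its threshold below [w]: take [a] at the first load that is off. *)
have [/existsP[k0 /andP[sk0 wk0]]|/existsPn noB] :=
  boolP [exists k, ~~ s (pi k) && (o k < w)].
  have [k sk kmin] := @arg_minnP _ k0 (fun k => ~~ s (pi k)) val sk0.
  have on_lt (i : bus n) : s (pi i) = (i < k)%N.
    apply/idP/idP => [si|].
      rewrite ltnNge leq_eqVlt; apply/negP => /orP[/eqP/val_inj ki|ki].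
        by rewrite ki si in sk.
      by rewrite (on_initial ki si) in sk.
    by rewrite ltnNge; apply: contraR => /kmin.
  exists (o k).
    by apply: rank => i; rewrite on_lt; case: ltnP => [/ltnW|] /o_sorted.
  apply: le_trans (dbar_sq_le_max (pi k)); rewrite -/(d k).
  have wk : o k < w by apply: le_lt_trans (o_sorted (kmin _ sk0)) wk0.
  have pk : pc <= pcmax net (pi k).
    by rewrite leNgt; apply: contra sk => /on_of_pcmax_lt.
  (* Here [D * (w - o k)] equals [pc - pcmin], at most the width of the hysteresis band and so less
     than [d k]. *)
  have := balance; rewrite sum_onE (eq_bigl _ _ on_lt).
  have := pcmax_gap (pi k); have := min_dbar_le (pi k); rewrite -/(d k) pcminE.
  move=> *; rewrite -sqrrN -mulrN opprB.
  rewrite lerXn2r ?nnegrE ?(ltW (d_gt0 k)) //; last by lra.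
  by rewrite mulr_ge0 ?subr_ge0 // ltW.
(* Neither violation occurs, so [w] itself separates and the loss is zero. *)
exists w.
  apply: rank => k; have := noC k; have := noB k.
  by case: (s (pi k)); rewrite /= ?orbF -leNgt.
rewrite subrr mulr0 expr0n /=.
exact: le_trans (sqr_ge0 _) (dbar_sq_le_max ord0).
Qed.

End Ranking.

End Network.

Theorem theorem5 (R : realType) (n : nat) (net : network R n)
    (Ch : bus n -> R -> R)
    (Ch_off : forall j, Ch j 0 = 0)
    (Ch_on : forall j, Ch j (dbar net j) = cd net j)
    (design : design_condition2 net)
    (alphaE : forall j, alpha net j = (c net j)^-1)
    (z : state net)
    (z_eq : equilibrium (network_system net) z) :
  eps_optimal (hoslc_feasible net) (hoslc_cost net Ch)
    (1 / (2 * total_damping net) * max_dbar_sq net)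
    (pM z, controllable_demand z, uncontrollable_demand z).
Proof.
have [flow fz] := equilibrium_flow z_eq; have [zL zadm] := flow.
have [pi [ratio_sorted om0 pcminE gap]] := design.
have D0 := total_damping_gt0 net.
pose w := omega z ord0; pose s j := sigma z j == 1.
have sE j : sigma z j = (s j)%:R.
  by rewrite /s; case: (zL j) => ->; rewrite ?eqxx // eq_sym oner_eq0.
pose dc := [ffun j => dbar net j * (s j)%:R].
have omE j : omega z j = w by apply: flow_equilibrium_omega.
have bal : total_damping net * w = power_command net - \sum_(j < n.+1) dc j.
  rewrite (flow_equilibrium_frequency fz); congr (_ - _).
  by apply: eq_bigr => j _; rewrite ffunE sE.
(* The equilibrium is the response to the common frequency [w] with the on-off pattern [s]. *)
have -> : (pM z, controllable_demand z, uncontrollable_demand z)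
    = ([ffun j => - (alpha net j * w)], dc, [ffun j => A net j * w]).
  congr (_, _, _); apply/ffunP => j; rewrite !ffunE ?sE ?omE //.
  by rewrite (flow_equilibrium_pM fz) omE.
have [a sep gap_a] : exists2 a : R,
    forall j, if s j then omega0 net j <= a else a <= omega0 net j
    & (total_damping net * (a - w)) ^+ 2 <= max_dbar_sq net.
  apply: (@separator_exists _ _ _ pi) => //.
  - by move=> k l kl; rewrite !om0 ratio_sorted.
  - by move=> j; case/andP: (gap j).
  - by rewrite bal; congr (_ - _); apply: eq_bigr => j _; rewrite ffunE.
  - by move=> j; rewrite -sE -(omE j).
have [q qopt] := hoslc_optimal_exists Ch alphaE.
split.
- rewrite mulr_gt0 ?divr_gt0 ?mulr_gt0 ?ltr0n //.
  apply: lt_le_trans (dbar_sq_le_max net ord0).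
  by rewrite exprn_gt0 ?dbar_gt0.
- apply: hoslc_feasible_droop bal => j; rewrite ffunE.
  by case: (s j); rewrite ?mulr1 ?mulr0; [right|left].
exists q => //; case: qopt => Fq _; case: q Fq => -[p dr] du Fq.
apply: le_trans (hoslc_cost_le_separated alphaE Ch_off Ch_on om0 sep bal Fq) _.
rewrite lerD2l.
(* The loss is rewritten through [D * (a - w)], the quantity that [gap_a] bounds; this produces the
   factor [1 / (2 * D)]. *)
have -> : total_damping net * (a - w) ^+ 2 / 2
    = 1 / (2 * total_damping net) * (total_damping net * (a - w)) ^+ 2.
  by field; rewrite gt_eqF.
by rewrite ler_wpM2l // divr_ge0 // mulr_ge0 // ltW.
Qed.
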